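(* Let $M=\bigoplus_{k\in\mathbb{Z}}\mathbb{C}v_k$ (with $\{v_k\}_{k\in\mathbb{Z}}$ a basis) be an irreducible Harish-Chandra $V_{p,q}$-module such that $L_nv_k\in\mathbb{C}v_{n+k}$ for all $n,k\in\mathbb{Z}$, $\mathrm{Ann}_M(L_{1})=\mathrm{Ann}_M(L_{-1})=0$, and $\frac{1}{p-q}\notin P(M)$. Then there exist $a,b\in\mathbb{C}$ such that $M\simeq M_{a,b}$ as $V_{p,q}$-modules.
   Context: Let $p,q\in\mathbb{C}$ be nonzero with $p\neq q$ and $q/p$ not a root of unity. For $n\in\mathbb{Z}$ put $[n]_{p,q}=\frac{p^{n}-q^{n}}{p-q}$. A $V_{p,q}$-module (module over the two parameters deformed Virasoro algebra) is a complex vector space $M$ together with linear operators $L_n:M\to M$ ($n\in\mathbb{Z}$) such that $(p^{-n}q^{n}L_nL_m-p^{-m}q^{m}L_mL_n)v=\big(\frac{[m]_{p,q}}{p^{m}}-\frac{[n]_{p,q}}{p^{n}}\big)L_{m+n}v$ for all $m,n\in\mathbb{Z}$ and $v\in M$. Submodules are subspaces stable under all $L_n$; a nonzero module is irreducible if it has no nonzero proper submodule. An isomorphism of $V_{p,q}$-modules is a linear bijection commuting with all $L_n$. A $V_{p,q}$-module $M$ is a Harish-Chandra module if $M=\bigoplus_{\lambda\in\mathbb{C}}M_\lambda$ with $M_\lambda=\{v\in M: L_0v=\lambda v\}$. The weight set is $P(M)=\{\lambda\in\mathbb{C}: M_\lambda\neq 0\}$. For $n\in\mathbb{Z}$, $\mathrm{Ann}_M(L_n)=\{v\in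 M: L_nv=0\}$. For $(a,b)\in\mathbb{C}\times\mathbb{C}$, $M_{a,b}$ is the $V_{p,q}$-module with basis $\{v_k\}_{k\in\mathbb{Z}}$ and action $L_n(v_k)=(p^{-k}[k]_{p,q}-ap^{-k}q^{k}-bp^{-k-n}q^{k}[n]_{p,q})v_{k+n}$ for all $n,k\in\mathbb{Z}$. *)

(* Defs.v *)
From HB Require Import structures.
From mathcomp Require Import all_boot all_order all_algebra.
From mathcomp Require Import ring.
From mathcomp Require Import boolp classical_sets reals.
From mathcomp Require Import complex.
From mathcomp Require Import freeg.

Set Implicit Arguments.
Unset Strict Implicit.
Unset Printing Implicit Defensive.

Import Order.TTheory GRing.Theory Num.Theory.

Local Open Scope classical_set_scope.
Local Open Scope ring_scope.

Section FamiliesOfVectors.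
Variables (K : fieldType) (I : eqType) (V : lmodType K).

(* [V] may be infinite-dimensional: linear combinations are finite sums,
   indexed by duplicate-free lists of indices. *)
Definition is_basis (v : I -> V) : Prop :=
  (forall x : V, exists (s : seq I) (c : I -> K),
     uniq s /\ x = \sum_(i <- s) c i *: v i) /\
  (forall (s : seq I) (c : I -> K), uniq s ->
     \sum_(i <- s) c i *: v i = 0 -> forall i, i \in s -> c i = 0).

Definition is_direct_sum (W : I -> set V) : Prop :=
  (forall x : V, exists (s : seq I) (y : I -> V),
     [/\ uniq s, forall i, W i (y i) & x = \sum_(i <- s) y i]) /\
  (forall (s : seq I) (y : I -> V), uniq s -> (forall i, W i (y i)) ->
     \sum_(i <- s) y i = 0 -> forall i, i \in s -> y i = 0).

End FamiliesOfVectors.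

Lemma fglift_is_linear (K : fieldType) (I : choiceType) (V : lmodType K)
  (f : I -> V) : linear (fglift f).
Proof.
have fB := lift_is_additive f.
have f0 : fglift f 0 = 0 by rewrite -[0 in LHS](subrr 0) fB subrr.
have fD u w : fglift f (u + w) = fglift f u + fglift f w.
  by rewrite -[w in LHS]opprK -[- w in LHS]sub0r !fB f0 sub0r opprK.
move=> c x y; rewrite fD; congr (_ + _).
elim/freeg_ind_dom0: x => [|z k x _ _ IH]; first by rewrite !(scaler0, f0).
rewrite scalerDr !fD IH scalerDr; congr (_ + _).
have -> : c *: << z *g k >> = << c * z *g k >> :> {freeg I / K}.
  by apply/eqP/freeg_eqP => j; rewrite coeffZ !coeffU mulrA.
by rewrite !liftU scalerA.
Qed.

Section DeformedVirasoro.
Variable R : realType.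
Local Notation C := (R[i]).

Definition qnum (p q : C) (n : int) : C := (p ^ n - q ^ n) / (p - q).

Record Vpq_module (p q : C) := VpqModule {
  Vpq_sort :> lmodType C;
  Vpq_op : int -> {linear Vpq_sort -> Vpq_sort};
  Vpq_rel : forall (m n : int) (x : Vpq_sort),
    (p ^ (- n) * q ^ n) *: Vpq_op n (Vpq_op m x)
    - (p ^ (- m) * q ^ m) *: Vpq_op m (Vpq_op n x)
    = (qnum p q m / p ^ m - qnum p q n / p ^ n) *: Vpq_op (m + n) x
}.

Section Notions.
Variables p q : C.
Implicit Types M : Vpq_module p q.

Definition is_submodule M (N : set M) : Prop :=
  submod_closed [in N] /\ forall (n : int) (x : M), N x -> N (Vpq_op M n x).

Definition irreducible M : Prop :=
  (exists x : M, x != 0) /\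
  (forall N : set M, is_submodule N -> N = [set 0] \/ N = setT).

Definition weight_space M (l : C) : set M :=
  [set x : M | Vpq_op M 0 x = l *: x].

Definition harish_chandra M : Prop := is_direct_sum (@weight_space M).

Definition weights M : set C := [set l | @weight_space M l <> [set 0]].

Definition Ann M (n : int) : set M := [set x : M | Vpq_op M n x = 0].

Definition isomorphic M M' : Prop :=
  exists f : {linear M -> M'},
    bijective f /\
    forall (n : int) (x : M), f (Vpq_op M n x) = Vpq_op M' n (f x).

End Notions.

Section Mab.
Variables (p q : C) (p_neq0 : p != 0) (q_neq0 : q != 0) (a b : C).

Definition Mab_coef (n k : int) : C :=
  p ^ (- k) * qnum p q k - a * p ^ (- k) * q ^ k
  - b * p ^ (- k - n) * q ^ k * qnum p q n.

(* The free vector space [{freeg int / C}] has the basis [<< k >>], [k : int],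
   and [fglift] extends a function on this basis by linearity. *)
Definition Mab_op (n : int) (x : {freeg int / C}) : {freeg int / C} :=
  fglift (fun k : int => << Mab_coef n k *g (k + n) >>) x.

Lemma Mab_op_is_linear (n : int) : linear (Mab_op n).
Proof. exact: fglift_is_linear. Qed.

HB.instance Definition _ (n : int) :=
  GRing.isLinear.Build C {freeg int / C} {freeg int / C} _ (Mab_op n)
    (Mab_op_is_linear n).

Lemma Mab_opE (n k : int) :
  Mab_op n << k >> = Mab_coef n k *: << k + n >>.
Proof.
rewrite /Mab_op liftU scale1r; apply/eqP/freeg_eqP => j.
by rewrite coeffZ !coeffU mul1r.
Qed.

Lemma Mab_rel (m n : int) (x : {freeg int / C}) :
  (p ^ (- n) * q ^ n) *: Mab_op n (Mab_op m x)
  - (p ^ (- m) * q ^ m) *: Mab_op m (Mab_op n x)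
  = (qnum p q m / p ^ m - qnum p q n / p ^ n) *: Mab_op (m + n) x.
Proof.
elim/freeg_ind_dom0: x => [|z k x _ _ IH]; first by rewrite !linear0 addr0.
rewrite !linearD /= addrACA IH; congr (_ + _).
have -> : << z *g k >> = z *: << k >> :> {freeg int / C}.
  by apply/eqP/freeg_eqP => j; rewrite coeffZ !coeffU mul1r.
have opZ i c w : Mab_op i (c *: w) = c *: Mab_op i w by rewrite linearZ.
rewrite !(opZ, Mab_opE) !scalerA.
have -> : k + n + m = k + (m + n) by rewrite -addrA [n + m]addrC.
rewrite addrA -scalerBl; congr (_ *: _).
rewrite /Mab_coef /qnum.
have -> : - k - (m + n) = - k - m - n by rewrite opprD addrA.
rewrite !opprD !expfzDr //= -!invr_expz.
have := expfz_neq0 k p_neq0; have := expfz_neq0 k q_neq0.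
have := expfz_neq0 m p_neq0; have := expfz_neq0 m q_neq0.
have := expfz_neq0 n p_neq0; have := expfz_neq0 n q_neq0.
move: (p ^ k) (q ^ k) (p ^ m) (q ^ m) (p ^ n) (q ^ n) (p - q)^-1.
move=> pk qk pm qm pn qn d ? ? ? ? ? ?.
by field; apply/and3P; split.
Qed.

Definition Mab : Vpq_module p q :=
  @VpqModule p q {freeg int / C} (fun n => Mab_op n) Mab_rel.

End Mab.

End DeformedVirasoro.

Arguments weight_space {R p q} M l.
Arguments Ann {R p q} M n.

(* Main.v *)
(** Put [t = q/p], [c = 1/(p - q)] and [L_n v_k = f n k v_(k+n)].  The defining
    relation with [m = 0], [n = 1] forces [f 0 k = c + theta x] with [x = t^k].
    Products of [f] along closed loops in the index [k] do not depend on the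
    scaling of the basis and obey first-order recursions in [k]: the loop of
    [L_1, L_-1] is a quadratic in [x], which factors as
    [(c + (A + B t) x) (c + (A t + B) x)] with [A + B = theta], as in the model;
    the loops of [L_2, L_-1, L_-1] and of [L_-2, L_1, L_1] are the model's cubic
    plus [mu x^3], resp. [nu x^3].  The product of these two loops is also the
    product of one loop of [L_2, L_-2] and two of [L_1, L_-1], which are
    quadratics in [x]; comparing both sides at infinitely many [x] leaves exactly
    two values of [(mu, nu)], exchanged by swapping [A] and [B].  Once the loops
    agree with the model, rescaling the basis makes [L_1], [L_-1], [L_2], [L_-2]
    agree, and these generate all [L_n]. *)
From HB Require Import structures.
Require Import Defs.
From mathcomp Require Import all_boot all_order all_algebra.
From mathcomp Require Import ring zify.
From mathcomp Require Import boolp classical_sets reals complex.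
From mathcomp Require Import freeg.

Import GRing.Theory Num.Theory.
Local Open Scope classical_set_scope.
Local Open Scope ring_scope.

(** * Recursions over the integers, and polynomials with infinitely many roots *)

Lemma geometric_int (K : fieldType) (r : K) (phi : int -> K) :
  r != 0 -> (forall k, phi (k + 1) = r * phi k) ->
  forall k, phi k = r ^ k * phi 0.
Proof.
move=> r0 H; elim=> [|n IH|n IH]; first by rewrite expr0z mul1r.
  by rewrite -addn1 PoszD H IH expfzDr // expr1z; ring.
have := H (- n.+1%:Z); have -> : - n.+1%:Z + 1 = - n%:Z :> int by lia.
rewrite IH => e; apply: (mulfI r0); rewrite -e mulrA; congr (_ * _).
have -> : - n%:Z = 1 + - n.+1%:Z :> int by lia.
by rewrite expfzDr // expr1z.
Qed.

Lemma gauge_exists (K : fieldType) (r : int -> K) :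
  (forall k, r k != 0) ->
  exists s : int -> K, (forall k, s k != 0) /\ forall k, s (k + 1) = r k * s k.
Proof.
move=> r0.
(* [Negz n] is -(n + 1): negative indices divide by the ratios at -1, ..., -(n + 1), and [s 0] is
   the empty product. *)
pose s (k : int) : K := match k with
  | Posz n => \prod_(i < n) r i
  | Negz n => (\prod_(i < n.+1) r (Negz i))^-1 end.
have s0 k : s k != 0.
  by case: k => n; rewrite /s ?invr_eq0; apply/prodf_neq0 => i _.
exists s; split => // -[n|n].
  by rewrite -PoszD addn1 /= big_ord_recr /= mulrC.
have -> : Negz n + 1 = - n%:Z :> int by lia.
case: n => [|n]; first by rewrite oppr0 /= big_ord0 big_ord1 mulfV.
rewrite -NegzE /= [in RHS]big_ord_recr /= invfM mulrCA mulfV ?mulr1 //.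
Qed.

Lemma poly_vanish_infinite (K : fieldType) (x : nat -> K) (P : {poly K}) :
  injective x -> (forall j, P.[x j] = 0) -> P = 0.
Proof.
move=> xI Px; apply/eqP/negPn/negP => P0.
have /(_ (map x (iota 0 (size P)))) := max_poly_roots P0.
rewrite map_inj_uniq // iota_uniq size_map size_iota ltnn => H.
have : all (root P) [seq x i | i <- iota 0 (size P)].
  by apply/allP => _ /mapP [j _ ->]; apply/rootP.
by move/H => /(_ isT).
Qed.

(** * Scalar cocycles, their loops and the recursions these obey *)

Section WeightCoefficients.
Variables (K : fieldType) (c t : K).
Hypothesis t0 : t != 0.

(** The relation of the algebra on [v_k], with t^n for p^(-n) q^n and c (1 - t^n) for [n]/p^n. *)
Definition Virasoro_cocycle (f : int -> int -> K) := forall m n k : int,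
  t ^ n * f m k * f n (k + m) - t ^ m * f n k * f m (k + n)
  = c * (t ^ n - t ^ m) * f (m + n) k.

(* The coefficients of [M_(a,b)], with [A = - c - a - b c] and [B = b c]. *)
Definition model (A B : K) (n k : int) : K := c + t ^ k * (A + B * t ^ n).

Lemma model_cocycle A B : Virasoro_cocycle (model A B).
Proof. by move=> m n k; rewrite /model !expfzDr //; ring. Qed.

Definition loop (f : int -> int -> K) (n k : int) : K := f (- n) (k + n) * f n k.

(* [raising_loop] of the model at [x = t^k]; exchanging [A] and [B] gives its
   [lowering_loop]. *)
Definition cubic (A B x : K) : K :=
  (c + x * (A + B * t ^+ 2)) * (c + x * (A * t + B)) * (c + t * x * (A * t + B)).

(** The relation between [L_n] and [L_-n] links loops n steps apart, hence the restriction to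
    multiples of n. Subtracting a particular solution leaves a geometric sequence of ratio [T ^+ 2],
    with initial value [y]. *)
Lemma loop_quadratic f theta n : Virasoro_cocycle f ->
  (forall k, f 0 k = c + theta * t ^ k) ->
  exists y, forall j : int, loop f n (n * j) =
    c ^+ 2 + c * theta * (1 + t ^ n) * (t ^ n) ^ j + y * ((t ^ n) ^ j) ^+ 2.
Proof.
move=> fV f0; set T := t ^ n; have T0 : T != 0 by apply: expfz_neq0.
pose phi j := loop f n (n * j) - c ^+ 2 - c * theta * (1 + T) * T ^ j.
have phiS j : phi (j + 1) = T ^+ 2 * phi j.
  have := fV (- n) n (n * j + n).
  rewrite addNr f0 addrK expfzDr // -invr_expz -/T => e.
  rewrite /phi /loop mulrDr mulr1 expfzDr // expr1z [T ^ j]exprz_exp.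
  set x := t ^ (n * j) in e *.
  set u := f (- n) (n * j + n) in e *; set v := f n (n * j) in e *.
  set w := f (- n) _ in e *; set z := f n _ in e *.
  have -> : w * z = T * (T^-1 * z * w) by field.
  move/(canRL (subrK _))/esym/(canRL (addKr _)) : e => ->.
  by field.
exists (phi 0) => j.
have := geometric_int _ _ _ (expf_neq0 2 T0) phiS j.
rewrite [T ^+ 2]exprnP exprzAC -exprnP => e.
rewrite -[loop _ _ _](subrK (c ^+ 2)) -[_ - _](subrK (c * theta * (1 + T) * T ^ j)).
by rewrite -/(phi j) e; ring.
Qed.

Definition raising_loop (f : int -> int -> K) (k : int) : K :=
  f 2 k * f (-1) (k + 2) * f (-1) (k + 1).

Definition lowering_loop (f : int -> int -> K) (k : int) : K :=
  f (-2) (k + 2) * f 1 k * f 1 (k + 1).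

Definition has_model_loop1 (A B : K) (f : int -> int -> K) : Prop :=
  forall k, loop f 1 k = (c + t ^ k * (A + B * t)) * (c + t ^ k * (A * t + B)).

Lemma loops_mul f k :
  raising_loop f k * lowering_loop f k
  = loop f 2 k * loop f 1 k * loop f 1 (k + 1).
Proof.
rewrite /raising_loop /lowering_loop /loop -[k + 1 + 1]addrA.
by rewrite (_ : 1 + 1 = 2%R :> int) //; ring.
Qed.

(** [cubic A B] is a particular solution, and differences of solutions are geometric of ratio t^3.
    The inhomogeneous term is symmetric in A and B, so [cubic B A] is a solution too. *)
Lemma cubic_recursion A B (W : int -> K) :
  (forall k, W (k + 1) = t ^+ 3 * W k + c * (1 - t ^+ 3) *
     ((c + t ^ (k + 1) * (A + B * t)) * (c + t ^ (k + 1) * (A * t + B)))) ->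
  exists mu, forall k, W k = cubic A B (t ^ k) + mu * (t ^ k) ^+ 3.
Proof.
move=> WS; pose phi k := W k - cubic A B (t ^ k).
have phiS k : phi (k + 1) = t ^+ 3 * phi k.
  by rewrite /phi WS expfzDr // expr1z /cubic; ring.
exists (phi 0) => k.
have := geometric_int _ _ _ (expf_neq0 3 t0) phiS k.
rewrite [t ^+ 3]exprnP exprzAC -exprnP => e.
by rewrite -[W k](subrK (cubic A B (t ^ k))) -/(phi k) e; ring.
Qed.

Lemma raising_loop_cubic A B f :
  Virasoro_cocycle f -> has_model_loop1 A B f ->
  exists mu, forall k, raising_loop f k = cubic A B (t ^ k) + mu * (t ^ k) ^+ 3.
Proof.
move=> fV f1; apply: cubic_recursion => k; rewrite -f1.
(* Multiplied by t and [f (-1) (k + 2)], this relation becomes the recursion between the raising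
   loops at k and k + 1. *)
have := fV 2 (-1) (k + 1).
rewrite addrK (_ : k + 1 + 2 = k + 3); last by lia.
rewrite (_ : 2 - 1 = 1%R :> int) //.
rewrite exprN1 -exprnP => e.
rewrite /raising_loop /loop (_ : k + 1 + 2 = k + 3); last by lia.
rewrite (_ : k + 1 + 1 = k + 2); last by lia.
have -> : f 2 (k + 1) * f (-1) (k + 3) * f (-1) (k + 2)
  = t * f (-1) (k + 2) * (t^-1 * f 2 (k + 1) * f (-1) (k + 3)) by field.
by move/(canRL (subrK _)) : e => ->; field.
Qed.

(** The expansion is around [cubic A B], although the lowering loop of the model is [cubic B A]; for
    the model [mu] is thus the difference of their x^3 coefficients. *)
Lemma lowering_loop_cubic A B f :
  Virasoro_cocycle f -> has_model_loop1 A B f ->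
  exists mu, forall k, lowering_loop f k = cubic A B (t ^ k) + mu * (t ^ k) ^+ 3.
Proof.
move=> fV f1; apply: cubic_recursion => k; rewrite -f1.
have := fV (-2) 1 (k + 2).
rewrite addrK (_ : k + 2 + 1 = k + 3); last by lia.
rewrite (_ : - 2 + 1 = (- 1)%R :> int) //.
rewrite expr1z -invr_expz -exprnP => e.
rewrite /lowering_loop /loop (_ : k + 1 + 2 = k + 3); last by lia.
rewrite (_ : k + 1 + 1 = k + 2); last by lia.
have -> : f (-2) (k + 3) * f 1 (k + 1) * f 1 (k + 2)
  = t ^+ 2 * f 1 (k + 1) * ((t ^+ 2)^-1 * f 1 (k + 2) * f (-2) (k + 3)) by field.
move/(canRL (subrK _))/esym/(canRL (addKr _)) : e => ->; field.
by [].
Qed.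

(** * Matching the loops with the model and rescaling the basis *)

Hypotheses (c0 : c != 0) (tI : injective (fun n : int => t ^ n)).

Lemma loop_dichotomy A B f :
  Virasoro_cocycle f -> (forall k, f 0 k = c + (A + B) * t ^ k) ->
  has_model_loop1 A B f ->
  (forall k, raising_loop f k = cubic A B (t ^ k)) /\
    (forall k, lowering_loop f k = cubic B A (t ^ k))
  \/ (forall k, raising_loop f k = cubic B A (t ^ k)) /\
    (forall k, lowering_loop f k = cubic A B (t ^ k)).
Proof.
move=> fV f0 f1.
have [mu E] := raising_loop_cubic _ _ _ fV f1.
have [nu F] := lowering_loop_cubic _ _ _ fV f1.
have [y H2] := loop_quadratic _ _ 2 fV f0.
(* The two cubics differ only in degree 3, by [delta]. *)
pose delta := t * ((A * t ^+ 2 + B) * (A + B * t) ^+ 2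
                   - (A + B * t ^+ 2) * (A * t + B) ^+ 2).
have swap x : cubic B A x = cubic A B x + delta * x ^+ 3.
  by rewrite /cubic /delta; ring.
(* Only even indices, where [H2] applies. *)
pose x (j : nat) := t ^ (2 * j%:Z).
have xI : injective x by move=> i j /tI ?; lia.
have x0 j : x j != 0 by apply: expfz_neq0.
(* [z] is the deviation of the x^2 coefficient of [loop f 2] from that of the model; [D] is the
   product of two successive loops of [L_1], [L_-1]. *)
pose z := y - (A + B * t ^+ 2) * (A * t ^+ 2 + B).
pose D (u : K) := (c + u * (A + B * t)) * (c + u * (A * t + B))
  * ((c + t * u * (A + B * t)) * (c + t * u * (A * t + B))).
(* This is [loops_mul] compared with its version for the model, divided by x^2. *)
have key j : x j * (mu + nu - delta) * cubic A B (x j) + mu * nu * x j ^+ 4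
             - z * D (x j) = 0.
  have := loops_mul f (2 * j%:Z); rewrite E F !f1 H2 exprz_exp -/(x j).
  rewrite expfzDr // expr1z -/(x j) -exprnP => e.
  apply: (mulfI (expf_neq0 2 (x0 j))); rewrite mulr0.
  move/eqP: e; rewrite -subr_eq0 => /eqP <-.
  by rewrite /cubic /D /z /delta; ring.
pose cubicX : {poly K} := (c%:P + 'X * (A + B * t ^+ 2)%:P)
  * (c%:P + 'X * (A * t + B)%:P) * (c%:P + t%:P * 'X * (A * t + B)%:P).
have cubicXE u : cubicX.[u] = cubic A B u.
  by rewrite /cubicX /cubic !hornerE.
(* As 0 is not a power of t, the identity is first made polynomial; its constant term is -z c^4. *)
have zE : z = 0.
  pose G : {poly K} := 'X * (mu + nu - delta)%:P * cubicX
    + (mu * nu)%:P * 'X ^+ 4 - z%:P *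
    ((c%:P + 'X * (A + B * t)%:P) * (c%:P + 'X * (A * t + B)%:P)
     * ((c%:P + t%:P * 'X * (A + B * t)%:P) * (c%:P + t%:P * 'X * (A * t + B)%:P))).
  have GE u : G.[u] = u * (mu + nu - delta) * cubic A B u + mu * nu * u ^+ 4 - z * D u.
    by rewrite /G !(hornerE, cubicXE, horner_exp).
  have G0 : G = 0 by apply: (poly_vanish_infinite _ _ _ xI) => j; rewrite GE key.
  have := GE 0; rewrite G0 horner0 /D => /esym/eqP.
  rewrite !(mul0r, mulr0, addr0, expr0n) /= add0r oppr_eq0 !mulf_eq0.
  by rewrite (negPf c0) !orbF => /eqP.
(* With [z] gone another factor x cancels, and the constant term becomes (mu + nu - delta) c^3. *)
have key2 j : (mu + nu - delta) * cubic A B (x j) + mu * nu * x j ^+ 3 = 0.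
  apply: (mulfI (x0 j)); rewrite mulr0 -[RHS](key j) zE; ring.
have sumE : mu + nu = delta.
  pose G : {poly K} := (mu + nu - delta)%:P * cubicX + (mu * nu)%:P * 'X ^+ 3.
  have GE u : G.[u] = (mu + nu - delta) * cubic A B u + mu * nu * u ^+ 3.
    by rewrite /G !(hornerE, cubicXE, horner_exp).
  have G0 : G = 0 by apply: (poly_vanish_infinite _ _ _ xI) => j; rewrite GE key2.
  have := GE 0; rewrite G0 horner0 /cubic => /esym/eqP.
  rewrite !(mul0r, mulr0, addr0, expr0n) /= !mulf_eq0 (negPf c0) !orbF subr_eq0.
  by move/eqP.
(* What remains is mu nu x^3 = 0, so (mu, nu) is (0, delta) or (delta, 0). *)
have := key2 0%N; rewrite sumE subrr mul0r add0r => /eqP.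
rewrite mulf_eq0 (negPf (expf_neq0 3 (x0 _))) orbF mulf_eq0 => /orP[] /eqP m0.
  left; split=> k; first by rewrite E m0 mul0r addr0.
  by rewrite F swap -sumE m0 add0r.
right; split=> k; last by rewrite F m0 mul0r addr0.
by rewrite E swap -sumE m0 addr0.
Qed.

(** For distinct m and n the scalar c (t^n - t^m) is invertible, so agreement at m and n passes to m
    + n. As 1 + 1 has equal summands, 1 and -1 alone would only reach 0; hence the seeds 2 and
    -2. *)
Lemma cocycle_gauge_extend f g (s : int -> K) :
  Virasoro_cocycle f -> Virasoro_cocycle g ->
  (forall n k, n \in [:: 1; -1; 2; -2] -> f n k * s k = g n k * s (k + n)) ->
  forall n k, f n k * s k = g n k * s (k + n).
Proof.
move=> fV gV small.
have step m n : m != n ->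
    (forall k, f m k * s k = g m k * s (k + m)) ->
    (forall k, f n k * s k = g n k * s (k + n)) ->
    forall k, f (m + n) k * s k = g (m + n) k * s (k + (m + n)).
  move=> mn Pm Pn k.
  have tmn : c * (t ^ n - t ^ m) != 0.
    by rewrite mulf_neq0 // subr_eq0; apply: contra_neq mn => /tI.
  apply: (mulfI tmn); rewrite !mulrA -fV -gV !mulrBl.
  congr (_ - _).
    rewrite -[LHS]mulrA [_ * s k]mulrC mulrA -[_ * s k]mulrA Pm.
    rewrite [k + (m + n)]addrA -!mulrA; congr (_ * (_ * _)).
    by rewrite mulrC Pn.
  rewrite -[LHS]mulrA [_ * s k]mulrC mulrA -[_ * s k]mulrA Pn.
  rewrite [m + n]addrC [k + (n + m)]addrA -!mulrA; congr (_ * (_ * _)).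
  by rewrite mulrC Pm.
have P0 k : f 0 k * s k = g 0 k * s (k + 0).
  by apply: (step 1 (-1)) => // j; apply: small; rewrite !inE.
have Ppos (m : nat) k : f m.+1 k * s k = g m.+1 k * s (k + m.+1).
  elim: m k => [|[|m] IH] k; try by apply: small; rewrite !inE.
  by rewrite -[m.+3%:Z]/(1 + m.+2%:Z); apply: step => // j; apply: small; rewrite !inE.
have Pneg (m : nat) k : f (- m.+1%:Z) k * s k = g (- m.+1%:Z) k * s (k + - m.+1%:Z).
  elim: m k => [|[|m] IH] k; try by apply: small; rewrite !inE.
  have -> : - m.+3%:Z = -1 + - m.+2%:Z by lia.
  by apply: step => // j; apply: small; rewrite !inE.
by case=> [[|m]|m] k; [exact: P0 | exact: Ppos | rewrite NegzE; exact: Pneg].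
Qed.

(** Choosing [s] makes [L_1] agree; the loop of [L_1], [L_-1] then forces agreement of [L_-1], the
    raising loop that of [L_2], the lowering loop that of [L_-2]. *)
Lemma model_gauge A B f :
  Virasoro_cocycle f ->
  (forall k, f 1 k != 0) -> (forall k, f (-1) k != 0) ->
  has_model_loop1 A B f ->
  (forall k, raising_loop f k = cubic A B (t ^ k)) ->
  (forall k, lowering_loop f k = cubic B A (t ^ k)) ->
  exists s : int -> K, (forall k, s k != 0) /\
    forall n k, f n k * s k = model A B n k * s (k + n).
Proof.
move=> fV f1 fm1 L1 E F.
(* Equal loops transfer nonvanishing from [f] to the model, so the ratios defining [s] are
   nonzero. *)
have gL k : model A B (-1) (k + 1) * model A B 1 k = loop f 1 k.
  by rewrite L1 /model expfzDr // expr1z exprN1; field.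
have g1 k : model A B 1 k != 0.
  have : model A B (-1) (k + 1) * model A B 1 k != 0 by rewrite gL mulf_neq0.
  by rewrite mulf_eq0 negb_or => /andP[].
have gm1 k : model A B (-1) (k + 1) != 0.
  have : model A B (-1) (k + 1) * model A B 1 k != 0 by rewrite gL mulf_neq0.
  by rewrite mulf_eq0 negb_or => /andP[].
have [|s [s0 sS]] := gauge_exists _ (fun k => f 1 k / model A B 1 k).
  by move=> k; rewrite mulf_neq0 ?invr_eq0.
exists s; split=> //; apply: cocycle_gauge_extend => //; first exact: model_cocycle.
have P1 k : f 1 k * s k = model A B 1 k * s (k + 1) by rewrite sS; field; apply: g1.
have Pm1 k : f (-1) (k + 1) * s (k + 1) = model A B (-1) (k + 1) * s k.
  apply: (mulfI (g1 k)); have := gL k; rewrite /loop => e.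
  rewrite mulrCA -P1 mulrA -e; ring.
have add2 k : k + 2 = k + 1 + 1 :> int by rewrite -addrA.
move=> n k; rewrite !inE => /or4P[] /eqP ->.
- exact: P1.
- by have := Pm1 (k - 1); rewrite subrK.
(* After multiplication by the two [L_-1] coefficients that close the loop, [Pm1] carries [s] from k
   + 2 down to k. *)
- have := E k; rewrite /raising_loop => e.
  have : model A B 2 k * model A B (-1) (k + 2) * model A B (-1) (k + 1)
         = cubic A B (t ^ k).
    by rewrite /model /cubic !expfzDr // expr1z exprN1; field.
  rewrite -e add2 => {}e.
  apply: (mulfI (mulf_neq0 (fm1 (k + 1)) (fm1 (k + 1 + 1)))).
  transitivity (f 2 k * f (-1) (k + 1 + 1) * f (-1) (k + 1) * s k); first by ring.
  rewrite -e.
  transitivity (model A B 2 k * f (-1) (k + 1) * (f (-1) (k + 1 + 1) * s (k + 1 + 1)));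
    last by ring.
  rewrite Pm1.
  transitivity (model A B 2 k * model A B (-1) (k + 1 + 1) * (f (-1) (k + 1) * s (k + 1)));
    last by ring.
  by rewrite Pm1; ring.
- have := F (k - 2); rewrite /lowering_loop subrK => e.
  have k1 : k - 2 + 1 + 1 = k by rewrite -addrA subrK.
  set j := k - 2 in e k1 *; rewrite -k1 in e *.
  have : model A B (-2) (j + 1 + 1) * model A B 1 j * model A B 1 (j + 1)
         = cubic B A (t ^ j).
    by rewrite /model /cubic !expfzDr // expr1z -invr_expz; field.
  rewrite -e => {}e.
  apply: (mulfI (mulf_neq0 (f1 j) (f1 (j + 1)))).
  transitivity (f (-2) (j + 1 + 1) * f 1 j * f 1 (j + 1) * s (j + 1 + 1)); first by ring.
  rewrite -e.
  transitivity (model A B (-2) (j + 1 + 1) * model A B 1 j * (model A B 1 (j + 1) * s (j + 1 + 1))); first by ring.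
  rewrite -P1.
  transitivity (model A B (-2) (j + 1 + 1) * f 1 (j + 1) * (model A B 1 j * s (j + 1))); first by ring.
  by rewrite -P1; ring.
Qed.
End WeightCoefficients.

(** * Classification of the cocycles over an algebraically closed field *)

Lemma weight_cocycle_classification (K : numClosedFieldType) (c t : K)
    (f : int -> int -> K) :
  t != 0 -> c != 0 -> injective (fun n : int => t ^ n) ->
  Virasoro_cocycle K c t f ->
  (forall k, f 1 k != 0) -> (forall k, f (-1) k != 0) ->
  exists (A B : K) (s : int -> K), (forall k, s k != 0) /\
    forall n k, f n k * s k = model K c t A B n k * s (k + n).
Proof.
move=> t0 c0 tI fV f1 fm1.
pose theta := f 0 0 - c.
have f0 k : f 0 k = c + theta * t ^ k.
  have phiS j : f 0 (j + 1) - c = t * (f 0 j - c).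
    apply: (mulfI (f1 j)); have := fV 0 1 j.
    rewrite expr1z expr0z addr0 add0r => e.
    have -> : f 1 j * (f 0 (j + 1) - c)
      = t * f 0 j * f 1 j - (t * f 0 j * f 1 j - 1 * f 1 j * f 0 (j + 1)) - c * f 1 j
      by ring.
    by rewrite e; ring.
  have := geometric_int _ _ (fun j => f 0 j - c) t0 phiS k.
  by move/(canRL (subrK _)) => ->; rewrite /theta; ring.
have [y H1] := loop_quadratic _ _ _ t0 _ _ 1 fV f0.
have t1 : t - 1 != 0.
  rewrite subr_eq0; apply/eqP => e.
  by have := tI 1 0; rewrite expr1z expr0z => /(_ e).
(* With A + B = theta and u = B (t - 1), the slopes of the two factors of the model's loop are theta
   + u and theta t - u; the quadratic formula makes their product [y]. *)
pose u := (theta * (t - 1)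
  + 2.-root (theta ^+ 2 * (t - 1) ^+ 2 - 4 * (y - theta ^+ 2 * t))) / 2.
have uE : (theta + u) * (theta * t - u) = y.
  have := rootCK (isT : 0 < 2)%N (theta ^+ 2 * (t - 1) ^+ 2 - 4 * (y - theta ^+ 2 * t)).
  rewrite /u; set r := 2.-root _ => rE.
  have -> : y = theta ^+ 2 * t + (theta ^+ 2 * (t - 1) ^+ 2 - r ^+ 2) / 4.
    by rewrite rE; field.
  by field.
pose B := u / (t - 1); pose A := theta - B.
have uB : u = B * (t - 1) by rewrite /B divfK.
have AB : A + B = theta by rewrite /A subrK.
have L1 : has_model_loop1 K c t A B f.
  move=> k; have := H1 k; rewrite mul1r expr1z => ->.
  by rewrite -uE uB /A; ring.
have L1' : has_model_loop1 K c t B A f by move=> k; rewrite L1; ring.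
rewrite -AB in f0.
(* [f0] and [L1] are symmetric in A and B, so the second case is the first with A and B
   exchanged. *)
case: (loop_dichotomy _ _ _ t0 c0 tI _ _ _ fV f0 L1) => -[E F].
  by exists A, B; apply: model_gauge.
by exists B, A; apply: model_gauge.
Qed.

(** * Free modules, rescaled bases and powers of t *)

Section FreeModule.
Variables (K : fieldType) (I : choiceType) (V : lmodType K) (v : I -> V).

HB.instance Definition _ :=
  GRing.isLinear.Build K {freeg I / K} V _ (fglift v) (fglift_is_linear v).

Lemma freegZ (a : K) (i : I) : << a *g i >> = a *: << i >> :> {freeg I / K}.
Proof. by apply/eqP/freeg_eqP => j; rewrite coeffZ !coeffU mul1r. Qed.

Lemma fglift_coeff (x : {freeg I / K}) :
  fglift v x = \sum_(i <- dom x) coeff i x *: v i.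
Proof.
by rewrite -[in LHS](freeg_sumE x) linear_sum; apply: eq_bigr => i _; apply: liftU.
Qed.

Lemma basis_neq0 : is_basis v -> forall i, v i != 0.
Proof.
move=> [_ v_free] i; apply/eqP => vi0.
have := v_free [:: i] (fun=> 1) isT; rewrite big_seq1 vi0 scaler0 => /(_ erefl i).
by rewrite mem_seq1 eqxx => /(_ isT)/eqP; rewrite oner_eq0.
Qed.

Lemma fglift_basis_bij : is_basis v -> bijective (fglift v).
Proof.
move=> [v_span v_free].
have surj y : exists x, fglift v x = y.
  have [s [a [_ ->]]] := v_span y.
  exists (\sum_(i <- s) << a i *g i >>); rewrite linear_sum.
  by apply: eq_bigr => i _; apply: liftU.
have ker x : fglift v x = 0 -> x = 0.
  rewrite fglift_coeff => /(v_free _ _ (uniq_dom x)) x0.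
  (* Coefficients on the support are nonzero, so their vanishing empties the support. *)
  apply/eqP; rewrite -dom_eq0; case: (dom x) (mem_dom x) x0 => // i r Hd /(_ i).
  by rewrite mem_head => /(_ isT) xi0; have := Hd i; rewrite mem_head xi0 eqxx.
have [g gK] := choice surj.
exists g => // x; apply/eqP; rewrite -subr_eq0; apply/eqP/ker.
by rewrite linearB /= gK subrr.
Qed.
End FreeModule.

Lemma is_basis_scale (K : fieldType) (I : eqType) (V : lmodType K)
    (v : I -> V) (s : I -> K) :
  (forall i, s i != 0) -> is_basis v -> is_basis (fun i => s i *: v i).
Proof.
move=> s0 [v_span v_free]; split=> [x|r a r_uniq].
  have [r [a [r_uniq ->]]] := v_span x.
  exists r, (fun i => a i / s i); split=> //.
  by apply: eq_bigr => i _; rewrite scalerA divfK.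
move=> e i ir; have := v_free r (fun i => a i * s i) r_uniq.
under eq_bigr do rewrite -scalerA.
by move=> /(_ e i ir)/eqP; rewrite mulf_eq0 (negPf (s0 i)) orbF => /eqP.
Qed.

Lemma bij_linear_inv (K : fieldType) (U V : lmodType K) (f : {linear U -> V}) :
  bijective f -> exists g : {linear V -> U}, cancel f g /\ cancel g f.
Proof.
case=> g fK gK.
have g_lin : linear g.
  by move=> a x y; apply: (can_inj fK); rewrite linearP !gK.
pose G := GRing.isLinear.Build K V U _ g g_lin.
pose gl : {linear V -> U} := HB.pack g G.
by exists gl.
Qed.

Lemma ratio_expz_inj (K : fieldType) (t : K) : t != 0 ->
  (forall n : nat, (0 < n)%N -> ~~ n.-unity_root t) ->
  injective (fun n : int => t ^ n).
Proof.
move=> t0 t_root.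
have pos (n : nat) (m : int) : t ^ (m + n.+1) != t ^ m.
  rewrite expfzDr // -[X in _ != X]mulr1 (inj_eq (mulfI (expfz_neq0 m t0))).
  by have := t_root n.+1 isT; rewrite unity_rootE.
move=> m n /= e; apply/eqP/negPn/negP => /eqP mn.
case: (ltrP m n) => mn'.
  have nE : n = m + (`|n - m|.-1.+1)%N by lia.
  by move/eqP: e; rewrite eq_sym nE (negPf (pos _ _)).
have mE : m = n + (`|m - n|.-1.+1)%N by lia.
by move/eqP: e; rewrite mE (negPf (pos _ _)).
Qed.

(** * From scalar coefficients back to modules *)

Theorem theorem3p4 (R : realType) (p q : R[i])
  (p_neq0 : p != 0) (q_neq0 : q != 0) (p_neq_q : p != q)
  (qp_not_root : forall n : nat, (0 < n)%N -> ~~ n.-unity_root (q / p))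
  (M : Vpq_module p q) (v : int -> M)
  (v_basis : is_basis v)
  (M_irr : irreducible M)
  (M_HC : harish_chandra M)
  (L_v : forall n k : int, exists c : R[i], Vpq_op M n (v k) = c *: v (n + k))
  (AnnL1 : Ann M 1 = [set 0])
  (AnnLm1 : Ann M (-1) = [set 0])
  (weight_cond : ~ weights M (1 / (p - q))) :
  exists a b : R[i], isomorphic M (Mab p_neq0 q_neq0 a b).
Proof.
pose t := q / p; pose c := (p - q)^-1.
have t0 : t != 0 by rewrite mulf_neq0 ?invr_eq0.
have c0 : c != 0 by rewrite invr_eq0 subr_eq0.
have tI := ratio_expz_inj _ _ t0 qp_not_root.
have tE n : t ^ n = p ^ (- n) * q ^ n by rewrite expfzMl exprz_inv mulrC.
have qnumE n : qnum p q n / p ^ n = c * (1 - t ^ n).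
  rewrite tE /qnum /c -invr_expz; have := expfz_neq0 n p_neq0.
  have : p - q != 0 by rewrite subr_eq0.
  by move: (p ^ n) (q ^ n) => P Q pq0 P0; field; apply/andP.
have [F FE] := choice (fun nk : int * int => L_v nk.1 nk.2).
pose f n k := F (n, k).
have fE n k : Vpq_op M n (v k) = f n k *: v (k + n) by rewrite (FE (n, k)) addrC.
have vI k (x y : R[i]) : x *: v k = y *: v k -> x = y.
  move/eqP; rewrite -subr_eq0 -scalerBl scaler_eq0 (negPf (basis_neq0 _ _ _ _ v_basis k)).
  by rewrite orbF subr_eq0 => /eqP.
have fV : Virasoro_cocycle _ c t f.
  move=> m n k; have := Vpq_rel m n (v k).
  have opZ i a x : Vpq_op M i (a *: x) = a *: Vpq_op M i x by rewrite linearZ.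
  rewrite !(opZ, fE) !scalerA -!tE !qnumE.
  rewrite [k + n + m]addrAC [k + (m + n)]addrA -scalerBl.
  move=> /vI => e; rewrite (_ : c * (t ^ n - t ^ m) = c * (1 - t ^ m) - c * (1 - t ^ n)).
    by rewrite -e; ring.
  by ring.
have f_neq0 n : Ann M n = [set 0] -> forall k, f n k != 0.
  move=> An k; apply/eqP => fnk0.
  have : Ann M n (v k) by rewrite /Ann /= fE fnk0 scale0r.
  by rewrite An => /eqP; apply/negP/basis_neq0.
have [A [B [s [s0 sE]]]] := weight_cocycle_classification _ _ _ _ t0 c0 tI fV
  (f_neq0 _ AnnL1) (f_neq0 _ AnnLm1).
(* These solve A = - c - a - b c and B = b c for a and b. *)
exists (- c - A - B), (B / c).
have MabE n k : Mab_coef p q (- c - A - B) (B / c) n k = model _ c t A B n k.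
  rewrite /Mab_coef /qnum /model !tE expfzDr // -!invr_expz.
  rewrite /c; have := expfz_neq0 n p_neq0; have := expfz_neq0 k p_neq0.
  have : p - q != 0 by rewrite subr_eq0.
  move: (p ^ n) (q ^ n) (p ^ k) (q ^ k) => P Q P' Q' pq0 P0 P0'.
  by field; apply/and3P.
(* On this basis [L_n] acts by the model's coefficients, so [fglift w] maps M_(a,b) isomorphically
   to M; the isomorphism sought is its inverse. *)
pose w k := s k *: v k.
have w_basis : is_basis w by apply: is_basis_scale.
have [g [fK gK]] := bij_linear_inv _ _ _ (fglift w) (fglift_basis_bij _ _ _ _ w_basis).
exists g; split; first by exists (fglift w).
move=> n x; apply: (can_inj fK); rewrite gK -[x in LHS]gK.
elim/freeg_ind_dom0: (g x) => [|z k y _ _ IH]; first by rewrite !linear0.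
rewrite !linearD /= IH; congr (_ + _).
rewrite freegZ !linearZ /=; congr (_ *: _).
rewrite Mab_opE linearZ /= !liftU !scale1r MabE /w linearZ /= fE !scalerA.
by rewrite mulrC sE.
Qed.
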